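(* Let $\mathcal{D}=(V,E,F)$ be an infinite cellular decomposition of a non-compact surface $S$. In hyperbolic background geometry, if $\Theta\in(0,\pi)^E$ satisfies condition (C1) (see context) and the initial curvature satisfies $K_i(r(0),\Theta)\le 0$ for all $v_i\in V$, then the solution $r(t)$ to the combinatorial Ricci flow $$\frac{\mathrm{d}r_i}{\mathrm{d}t}=-K_i\sinh r_i,\qquad\forall v_i\in V,$$ with initial value $r(0)$ converges to a good ideal circle pattern. That is, for every $v_i\in V$ the limit $r_i(\infty)=\lim_{t\to\infty}r_i(t)\in(0,\infty)$ exists, and $K_i(r(\infty),\Theta)=0$ for all $v_i\in V$.
   Context: $V,E,F$ are the sets of vertices, edges and faces of $\mathcal{D}$; $j\sim i$ means that $v_i,v_j$ are joined by an edge $[v_i,v_j]\in E$. Each vertex has finite degree, and the graph distance in the 1-skeleton $(V,E)$ between any two vertices is finite. $\Theta:E\to(0,\pi)$ is the intersection angle function, and $\Theta_{ij}=\Theta([v_i,v_j])$. Condition (C1): if edges $e_1,\dots,e_m$ form the boundary of a face, then $\sum_{l=1}^m\Theta(e_l)=(m-2)\pi$. A circle packing metric is a function $r:V\to(0,\infty)$, with $r_i=r(v_i)$. For an edge $[v_i,v_j]$, consider the hyperbolic triangle $v_iv_jv_f$ with $|v_iv_f|=r_i$, $|v_jv_f|=r_j$ and $|v_iv_j|=l_{ij}=\cosh^{-1}(\cosh r_i\cosh r_j+\sinh r_i\sinh r_j\cos\Theta_{ij})$; let $\theta_{ij}$ be its inner angle at $v_i$. The discrete Gaussian (vertex) curvature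 at $v_i$ is $2\pi$ minus the total cone angle at $v_i$, i.e. $K_i=K_i(r,\Theta)=2\pi-2\sum_{j\sim i}\theta_{ij}(r_i,r_j)$. In the flow, $K_i$ is evaluated at $r(t)$. A good ideal circle pattern is a circle packing metric with zero discrete Gaussian curvature at every vertex. *)

(* Defs.v *)
From HB Require Import structures.
From mathcomp Require Import all_boot all_order all_algebra.
From mathcomp Require Import all_classical all_reals all_analysis.

Set Implicit Arguments.
Unset Strict Implicit.
Unset Printing Implicit Defensive.

Import Order.TTheory GRing.Theory Num.Theory.
Import numFieldNormedType.Exports.

Local Open Scope classical_set_scope.
Local Open Scope ring_scope.

(* A topological 2-manifold without boundary; [f] and [g] are a chart and its
   inverse. *)
Definition is_surface (R : realType) (S : topologicalType) : Prop :=
  [/\ hausdorff_space S, @second_countable S &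
      forall x : S, exists (U : set S) (W : set (R * R))
                           (f : S -> R * R) (g : R * R -> S),
        [/\ open U /\ U x, open W,
            {within U, continuous f} /\ {within W, continuous g},
            forall y, U y -> W (f y) /\ g (f y) = y &
            forall z, W z -> U (g z) /\ f (g z) = z]].

Definition closed_disk (R : realType) : set (R * R) :=
  [set p | p.1 ^+ 2 + p.2 ^+ 2 <= 1].
Definition open_disk (R : realType) : set (R * R) :=
  [set p | p.1 ^+ 2 + p.2 ^+ 2 < 1].

(* A locally finite decomposition of [S] into open cells of dimension 0, 1, 2,
   given by characteristic maps.  An edge is determined by its unordered pair
   of distinct endpoints, so E is encoded by the symmetric relation [adj];
   [edge_map i j] and [edge_map j i] are the two parametrizations of the edge
   [v_i, v_j].  The values of [edge_map i j] outside [0, 1] or for non-adjacent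
   i, j, and those of [face_map f] outside the closed disk, are irrelevant. *)
Record cell_decomposition (R : realType) (S : topologicalType) : Type :=
  CellDecomposition {
  vertex : choiceType;
  adj : vertex -> vertex -> Prop;
  face : Type;
  vertex_pt : vertex -> S;
  edge_map : vertex -> vertex -> R -> S;
  face_map : face -> R * R -> S;
  (* The boundary of f is the closed walk corner f 0, ..., corner f m with
     m = face_size f. *)
  face_size : face -> nat;
  corner : face -> nat -> vertex;
  open_edge := fun i j => edge_map i j @` `]0, 1[;
  open_face := fun f => face_map f @` @open_disk R;
  adj_sym : forall i j, adj i j -> adj j i;
  adj_irrefl : forall i, ~ adj i i;
  vertex_pt_inj : injective vertex_pt;
  edge_map_continuous : forall i j, adj i j ->
    {within `[0, 1], continuous (edge_map i j)};
  edge_map_inj : forall i j, adj i j -> {in `]0, 1[ &, injective (edge_map i j)};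
  edge_map0 : forall i j, adj i j -> edge_map i j 0 = vertex_pt i;
  edge_map_rev : forall i j, adj i j ->
    {in `[0, 1], forall t, edge_map j i t = edge_map i j (1 - t)};
  face_map_continuous : forall f,
    {within @closed_disk R, continuous (face_map f)};
  face_map_inj : forall f p q, @open_disk R p -> @open_disk R q ->
    face_map f p = face_map f q -> p = q;
  face_size_gt0 : forall f, (0 < face_size f)%N;
  corner_closed : forall f, corner f (face_size f) = corner f 0%N;
  corner_adj : forall f l, (l < face_size f)%N ->
    adj (corner f l) (corner f l.+1);
  (* The l-th of m equal arcs of the unit circle is mapped onto the l-th
     boundary edge. *)
  face_map_boundary : forall f l, (l < face_size f)%N ->
    {in `[0, 1], forall t : R,
      let a := 2 * pi * (l%:R + t) / (face_size f)%:R in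
      face_map f (cos a, sin a) = edge_map (corner f l) (corner f l.+1) t};
  vertex_edge_disjoint : forall v i j, adj i j -> ~ open_edge i j (vertex_pt v);
  vertex_face_disjoint : forall v f, ~ open_face f (vertex_pt v);
  edge_edge_disjoint : forall i j k l, adj i j -> adj k l ->
    open_edge i j `&` open_edge k l !=set0 ->
    (i = k /\ j = l) \/ (i = l /\ j = k);
  edge_face_disjoint : forall i j f, adj i j ->
    open_edge i j `&` open_face f = set0;
  face_face_disjoint : forall f g, open_face f `&` open_face g !=set0 -> f = g;
  cells_cover : forall x : S, [\/ exists v, x = vertex_pt v,
    exists i j, adj i j /\ open_edge i j x | exists f, open_face f x];
  cells_locally_finite : forall x : S, exists2 U : set S, nbhs x U &
    [/\ finite_set [set v | U (vertex_pt v)],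
        finite_set [set e : vertex * vertex |
          adj e.1 e.2 /\ open_edge e.1 e.2 `&` U !=set0] &
        finite_set [set f | open_face f `&` U !=set0]];
  degree_finite : forall i, finite_set [set j | adj i j];
  graph_connected : forall i j, exists (n : nat) (w : nat -> vertex),
    [/\ w 0%N = i, w n = j & forall k, (k < n)%N -> adj (w k) (w k.+1)]
}.

Section Patterns.
Variables (R : realType) (S : topologicalType) (D : cell_decomposition R S).
Implicit Types (Theta : vertex D -> vertex D -> R) (r : vertex D -> R).

(* Functions E -> (0, pi), as symmetric functions of the endpoints. *)
Definition intersection_angle Theta : Prop := forall i j, adj i j ->
  Theta i j = Theta j i /\ 0 < Theta i j < pi.

Definition condition_C1 Theta : Prop := forall f : face D,
  \sum_(l < face_size f) Theta (corner f l) (corner f l.+1) =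
  ((face_size f)%:R - 2) * pi.

Definition circle_packing_metric r : Prop := forall i, 0 < r i.

Definition cosh (x : R) : R := (expR x + expR (- x)) / 2.
Definition sinh (x : R) : R := (expR x - expR (- x)) / 2.
(* Inverse of cosh on [1, +oo[. *)
Definition arcosh (x : R) : R := ln (x + Num.sqrt (x ^+ 2 - 1)).

(* Angle opposite to the side a in the hyperbolic triangle with side lengths
   a, b, c (hyperbolic law of cosines). *)
Definition hyp_angle (a b c : R) : R :=
  acos ((cosh b * cosh c - cosh a) / (sinh b * sinh c)).

Definition edge_length (ri rj Th : R) : R :=
  arcosh (cosh ri * cosh rj + sinh ri * sinh rj * cos Th).

Definition inner_angle (ri rj Th : R) : R :=
  hyp_angle rj ri (edge_length ri rj Th).

Definition curvature Theta r (i : vertex D) : R :=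
  2 * pi - 2 * \sum_(j \in [set j | adj i j]) inner_angle (r i) (r j) (Theta i j).

Definition good_ideal_circle_pattern Theta r : Prop :=
  circle_packing_metric r /\ forall i, curvature Theta r i = 0.

(* [l] is the derivative of [f] at [t] relative to [0, +oo[; it is one-sided
   at t = 0. *)
Definition is_derive_nneg (f : R -> R) (t l : R) : Prop :=
  (fun s => (f s - f t) / (s - t)) @ within (`[0, +oo[ `\ t) (nbhs t) --> l.

Definition ricci_flow Theta (r : R -> vertex D -> R) : Prop :=
  forall t, 0 <= t -> circle_packing_metric (r t) /\
    forall i, is_derive_nneg (r ^~ i) t (- curvature Theta (r t) i * sinh (r t i)).

End Patterns.

(* Main.v *)
Require Import Defs.
From mathcomp Require Import all_boot all_order all_algebra.
From mathcomp Require Import finmap.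
From mathcomp Require Import all_classical all_reals all_analysis.
From mathcomp Require Import ring lra.
Import Order.TTheory GRing.Theory Num.Theory.
Import numFieldNormedType.Exports.
Local Open Scope classical_set_scope.
Local Open Scope ring_scope.

(** Put u_i = ln (tanh (r_i / 2)) < 0.  The flow becomes u_i' = - K_i, with
    K_i = 2 pi - 2 sum_j theta_ij, and theta_ij grows when u_j grows
    ([le_angle_r]) and when u_i and u_j decrease by the same amount
    ([le_angle_scale]).

    Suppose first that every u_i is nondecreasing in time, i.e. that K_i <= 0 is
    preserved.  Then the angles at v_i always add up to at least pi.  As
    theta_ij tends to 0 when u_i tends to 0, uniformly in u_j
    ([angle_vanishing]), u_i stays away from 0 and converges to a negative
    limit.  The curvature of the limit is at most 0, and it is not negative
    since u_i would otherwise grow linearly ([log_flow_cvg]).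

    Monotonicity is a maximum principle on an infinite graph, applied to the
    penalized drops u_i(s) - u_i(t) - g t with s <= t and g > 0.  At a largest
    one, with drop D, the choice of s gives K_i(u(s)) <= 0 (for s = 0 this is
    the hypothesis on the initial curvature), the choice of t gives
    K_i(u(t)) >= g, and no u_j drops by more than D between s and t, whence
    K_i(u(t)) <= K_i(u(s)) <= 0 by the two monotonicity properties: a
    contradiction.  On an infinite graph only almost largest drops exist, and
    u_j may drop by D + d with a small d.  What this adds to K_i(u(t)) depends
    on the edge.

    - While Theta_ij stays away from pi, the logarithmic derivative of theta_ij
      in u_j is bounded ([angle_light_edge]).  Hence the error is a small
      multiple of sum_j theta_ij, whatever the degree of v_i
      ([log_curvature_drop]).

    - If Theta_ij is close to pi, the edge is called heavy and nothing bounds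
      this derivative.  But theta_ij + theta_ji, which is Theta_ij minus the
      area of a triangle, is then nearly pi as soon as u_i and u_j are bounded
      away from 0 ([angle_heavy_edge]), so along a chain of n heavy edges the
      curvatures add up to little more than 2 pi ([chain_curvature]).

    So if a heavy neighbour of v_i has a larger drop than v_i, move to it, and
    repeat.  The vertices met are distinct, and since u decreases at speed at
    most 2 pi, almost largest drops at nearby times force all of them to have
    decreased at average speed at least g / 2 over a common earlier time window.
    The bound on the sum of their curvatures therefore limits their number
    ([no_late_chain]): the walk ends at a vertex where heavy neighbours do not
    drop more, and there the first case applies ([drops_le_step]). *)

Set Implicit Arguments.
Unset Strict Implicit.
Unset Printing Implicit Defensive.

(** * Calculus on the half line *)

Section Calculus.
Variable R : realType.
Implicit Types (f df : R -> R) (s t l c : R).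

Lemma increment_ge f df s t c : s <= t -> continuous f ->
  (forall x, s < x -> x < t -> is_derive x 1 f (df x)) ->
  (forall x, s < x -> x < t -> c <= df x) -> c * (t - s) <= f t - f s.
Proof.
rewrite le_eqVlt => /predU1P[->|st] fc fd dfc; first by rewrite !subrr mulr0.
have [||x] := @MVT R f df s t st.
- by move=> x; rewrite in_itv/= => /andP[*]; apply: fd.
- exact: continuous_subspaceT.
rewrite in_itv/= => /andP[sx xt] ->.
by rewrite ler_wpM2r ?dfc// subr_ge0 ltW.
Qed.

(** Only the past of [t] enters: [t] may be the right end of the interval on
    which a maximum is taken. *)
Lemma derive_ge_left f t l s c : s < t -> is_derive t 1 f l ->
  (forall x, s <= x -> x < t -> c * (t - x) <= f t - f x) -> c <= l.
Proof.
move=> st [fd <-] H.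
rewrite ['D_1 f t]cvg_at_leftE; last exact: fd.
apply: limr_ge.
  rewrite -(cvg_at_leftE (fun h => h^-1 *: ((f \o shift t) _ - f t)))//.
  apply: cvg_trans fd; apply: cvg_app.
  move=> A [e egt0 Ae]; exists e => // x xe xgt0; apply: Ae => //.
  exact/ltr0_neq0.
near=> h.
have h0 : h < 0 by near: h; exists 1 => /=.
have hs : s <= t + h.
  near: h; exists (t - s) => /=; first by rewrite subr_gt0.
  move=> h /=; rewrite sub0r normrN => hts h0.
  by move: hts; rewrite ltr0_norm//; lra.
rewrite /= /shift /= [_%:A]mulr1 [X in X <= _](_ : _ = h^-1 * (c * h)); last first.
  by field; rewrite lt_eqF.
rewrite /GRing.scale/= ler_nM2l ?invr_lt0//.
have := H (t + h) hs; rewrite (addrC h t); lra.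
Unshelve. all: by end_near. Qed.

Lemma derive_ge0_left_max f t l s : s < t -> is_derive t 1 f l ->
  (forall x, s <= x -> x < t -> f x <= f t) -> 0 <= l.
Proof.
move=> st fd H; apply: (derive_ge_left st fd) => x sx xt.
by rewrite mul0r subr_ge0 H.
Qed.

(** The drops are maximized over the compact triangle 0 <= p.1 <= p.2 <= t. *)
Lemma max_drop f t (g : R) : 0 <= t -> continuous f ->
  exists p : R * R, [/\ 0 <= p.1, p.1 <= p.2, p.2 <= t &
   forall x y, 0 <= x -> x <= y -> y <= t ->
     f x - f y - g * y <= f p.1 - f p.2 - g * p.2].
Proof.
move=> t0 fc.
pose A : set (R * R) := `[0, t] `*` `[0, t] `&` [set p | p.1 <= p.2].
have A0 : A !=set0.
  by exists (0, t); rewrite /A /= !in_itv/= lexx t0 lexx.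
have cA : compact A.
  apply: compact_closedI.
    by apply: compact_setX; exact: segment_compact.
  have -> : [set p : R * R | p.1 <= p.2] = (fun p : R * R => p.2 - p.1) @^-1` [set x | 0 <= x].
    by apply/seteqP; split => p /=; rewrite subr_ge0.
  apply: preimage_closed; last exact: closed_ge.
  by move=> p _; apply: cvgB; [exact: cvg_snd|exact: cvg_fst].
have cF : continuous (fun p : R * R => f p.1 - f p.2 - g * p.2).
  move=> p; apply: cvgB; last by apply: cvgM; [exact: cvg_cst|exact: cvg_snd].
  apply: cvgB; apply: continuous_cvg; try exact: fc.
    exact: cvg_fst.
  exact: cvg_snd.
have [p + H] := compact_EVT_max A0 cA (continuous_subspaceT cF).
rewrite inE /A /= !in_itv/= => -[[/andP[p0 _] /andP[_ pt]] p12].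
exists p; split => // x y x0 xy yt; apply: (H (x, y)).
rewrite inE /A /= !in_itv/= x0 xy yt !andbT; split=> //; split.
  exact: le_trans xy yt.
exact: le_trans x0 xy.
Qed.

End Calculus.

Section OneSided.
Variable R : realType.
Implicit Types (f : R -> R) (t l : R).

Lemma is_derive_nneg_is_derive f t l : 0 < t -> is_derive_nneg f t l ->
  is_derive t 1 f l.
Proof.
move=> t0 fd.
have H : (fun h => h^-1 *: ((f \o shift t) (h *: (1 : R)) - f t)) @ 0^' --> l.
  have S : (fun h : R => h + t) @ 0^' --> within (`[0, +oo[ `\ t) (nbhs t).
    move=> B /nbhs_ballP[e /= e0 eB].
    exists (Num.min e t); first by rewrite /= lt_min e0.
    move=> h; rewrite /= sub0r normrN lt_min => /andP[he ht] h0.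
    apply: eB => /=; first by rewrite /ball/= opprD addrCA subrr addr0 normrN.
    split; first by rewrite in_itv/= andbT; have := ler_norm (- h); rewrite normrN; lra.
    by move=> /eqP; rewrite -subr_eq0 addrK; apply/negP.
  have := cvg_comp _ _ S fd; apply: cvg_trans; apply: near_eq_cvg.
  near=> h => /=; rewrite /shift/= addrK [_ *: 1]mulr1 mulrC; reflexivity.
apply: DeriveDef; first by apply/cvg_ex; exists l.
exact: cvg_lim.
Unshelve. all: by end_near. Qed.

(** Freezing the function at its initial value for negative times makes it
    continuous on the whole line, as the compactness and mean value arguments
    want it. *)
Lemma is_derive_nneg_continuous f : (forall t, 0 <= t -> exists l, is_derive_nneg f t l) ->
  continuous (fun t => f (Num.max 0 t)).
Proof.
move=> fd t; set t' := Num.max 0 t.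
have t'0 : 0 <= t' by rewrite le_max lexx.
have [l fl] := fd _ t'0.
apply/cvgrPdist_lt => e e0.
have : (fun x => (f x - f t') / (x - t') * (x - t')) @
    within (`[0, +oo[ `\ t') (nbhs t') --> l * (t' - t').
  apply: cvgM => //.
  have idt : (fun x => x - t') @ nbhs t' --> t' - t'.
    by apply: cvgB; [exact: cvg_id|exact: cvg_cst].
  exact: (@cvg_within_filter _ _ _ _ _ _ _ idt).
rewrite subrr mulr0 => /cvgrPdist_lt/(_ e e0) nf.
have mc : {for t, continuous (fun s : R => Num.max 0 s)}.
  have cid : {for t, continuous (@id R)} by exact: cvg_id.
  have c0 : {for t, continuous (@cst R R 0)} by exact: cvg_cst.
  exact: (continuous_max c0 cid).
have nf' : \forall s \near t, (`[0, +oo[ `\ t') (Num.max 0 s) ->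
    `|0 - (f (Num.max 0 s) - f t') / (Num.max 0 s - t') * (Num.max 0 s - t')| < e.
  exact: mc _ nf.
near=> s.
have : (`[0, +oo[ `\ t') (Num.max 0 s) ->
    `|0 - (f (Num.max 0 s) - f t') / (Num.max 0 s - t') * (Num.max 0 s - t')| < e.
  by near: s.
have [->|st] := eqVneq (Num.max 0 s) t'; first by rewrite subrr normr0.
have s0 : 0 <= Num.max 0 s by rewrite le_max lexx.
rewrite sub0r normrN divfK ?subr_eq0// distrC; apply; split; last exact/eqP.
by rewrite /= in_itv/= s0.
Unshelve. all: by end_near. Qed.

End OneSided.

(** * The angle as a function of the half-radius tangents *)

Section Angle.
Variable R : realType.
Implicit Types T a b c d k l q x y : R.

Definition acot x : R := pi / 2 - atan x.

Lemma acot_gt0 x : 0 < acot x.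
Proof. by rewrite subr_gt0 atan_ltpi2. Qed.

Lemma acot_ltpi x : acot x < pi.
Proof. have := atan_gtNpi2 x; rewrite /acot; lra. Qed.

Lemma le_acot x y : x <= y -> acot y <= acot x.
Proof. by move=> xy; rewrite lerB// le_atan. Qed.

Lemma sin_atan x : sin (atan x) = x / Num.sqrt (1 + x ^+ 2).
Proof.
have c0 : cos (atan x) != 0.
  by rewrite gt_eqF// cos_gt0_pihalf// atan_gtNpi2 atan_ltpi2.
by rewrite -[X in X / _]atanK /tan -cos_atan divfK.
Qed.

Lemma cos_acot x : cos (acot x) = x / Num.sqrt (1 + x ^+ 2).
Proof. by rewrite /acot -opprB cosN cosBpihalf sin_atan. Qed.

Lemma sin_acot x : sin (acot x) = (Num.sqrt (1 + x ^+ 2))^-1.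
Proof. by rewrite /acot -opprB sinN sinBpihalf opprK cos_atan. Qed.

Lemma sin_le x : 0 <= x -> sin x <= x.
Proof.
move=> x0; have [c _] := @MVT_segment R sin cos 0 x x0 (fun=> _)
  (continuous_subspaceT (@continuous_sin R)).
rewrite sin0 !subr0 => ->.
by rewrite ler_piMl// cos_le1.
Qed.

Lemma expR_neg_itv y : y < 0 -> 0 < expR y < 1.
Proof. by move=> y0; rewrite expR_gt0/= expR_lt1. Qed.

Lemma cos_gtN1 T : 0 < T < pi -> - 1 < cos T.
Proof.
move=> T0pi; have s0 := sin_gt0_pi T0pi; have := cos2Dsin2 T.
have := cos_geN1 T; rewrite le_eqVlt => /predU1P[<-|//].
rewrite sqrrN expr1n => /eqP; rewrite -subr_eq0 addrAC subrr add0r.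
by rewrite sqrf_eq0 gt_eqF.
Qed.

Definition cot_angle T a b : R :=
  (a / b + a * b + (1 + a ^+ 2) * cos T) / ((1 - a ^+ 2) * sin T).

(** In the triangle with sides [r], [s] enclosing the angle [pi - T], this is the
    angle opposite to [s], for [a = tanh (r / 2)] and [b = tanh (s / 2)]; see
    [inner_angleE]. *)
Definition angle T a b : R := acot (cot_angle T a b).

Lemma angle_gt0 T a b : 0 < angle T a b. Proof. exact: acot_gt0. Qed.

Lemma cot_angle_den_gt0 T a : 0 < T < pi -> 0 < a < 1 ->
  0 < (1 - a ^+ 2) * sin T.
Proof.
move=> T0pi /andP[a0 a1]; rewrite mulr_gt0 ?sin_gt0_pi//.
by rewrite subr_gt0 expr_lt1// ltW.
Qed.

Lemma le_angle_r T a b b' : 0 < T < pi -> 0 < a < 1 -> 0 < b -> b <= b' ->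
  b' <= 1 -> angle T a b <= angle T a b'.
Proof.
move=> T0pi a01 b0 bb' b'1; apply: le_acot.
rewrite ler_pM2r ?invr_gt0 ?cot_angle_den_gt0// lerD2r.
have b'0 : 0 < b' by apply: lt_le_trans bb'.
rewrite -subr_ge0.
have -> : a / b + a * b - (a / b' + a * b') =
   a * (b' - b) * (1 - b * b') / (b * b').
  by field; rewrite !gt_eqF.
case/andP: a01 => a0 _.
rewrite divr_ge0 ?mulr_ge0 ?(ltW a0) ?subr_ge0 ?(ltW b0) ?(ltW b'0)//.
by rewrite mulr_ile1 ?(ltW b0) ?(ltW b'0) ?(le_trans bb').
Qed.

(** Put the third vertex at the centre of the Poincare disk: the other two are
    at Euclidean distances [a] and [b], and each angle there is the one of the
    Euclidean triangle minus half the hyperbolic area.  Scaling by [l] keeps the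
    former and reduces the latter. *)
Lemma le_angle_scale T a b l : 0 < T < pi -> 0 < a < 1 -> 0 < b < 1 ->
  0 < l <= 1 -> angle T a b <= angle T (l * a) (l * b).
Proof.
move=> T0pi a01 b01 /andP[l0 l1]; apply: le_acot.
have [/andP[a0 a1] /andP[b0 b1]] := (a01, b01).
have s0 : 0 < sin T by rewrite sin_gt0_pi.
have c1 : - 1 <= cos T by apply: cos_geN1.
have la01 : 0 < l * a < 1.
  by rewrite mulr_gt0//= (le_lt_trans _ a1)// ler_piMl// ltW.
have D1 := cot_angle_den_gt0 T0pi a01.
have D2 := cot_angle_den_gt0 T0pi la01.
rewrite /cot_angle ler_pdivrMr// [leRHS]mulrAC ler_pdivlMr//.
rewrite -subr_ge0.
have -> : (a / b + a * b + (1 + a ^+ 2) * cos T) *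
    ((1 - (l * a) ^+ 2) * sin T) -
   (l * a / (l * b) + l * a * (l * b) + (1 + (l * a) ^+ 2) * cos T) *
   ((1 - a ^+ 2) * sin T) =
   sin T * (1 - l ^+ 2) * (a * b + a ^+ 2 * (a / b) + 2 * a ^+ 2 * cos T).
  by field; rewrite !gt_eqF.
rewrite mulr_ge0//.
  by rewrite mulr_ge0 ?(ltW s0)// subr_ge0 expr_le1// ltW.
have -> : a * b + a ^+ 2 * (a / b) + 2 * a ^+ 2 * cos T =
  (a * (a - b) ^+ 2) / b + 2 * a ^+ 2 * (1 + cos T).
  by field; rewrite gt_eqF.
rewrite addr_ge0//; first by rewrite divr_ge0 ?(ltW b0)// mulr_ge0 ?sqr_ge0 ?(ltW a0).
have c1' : 0 <= 1 + cos T by lra.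
by rewrite mulr_ge0// mulr_ge0// sqr_ge0.
Qed.

(** For [c = cos T], [X = a / b] and [Y = a * b], the right-hand side is
    [((1 - a ^+ 2) * sin T) ^+ 2 * (1 + cot_angle T a b ^+ 2)].  It factors as
    [(X ^+ 2 + 2 * c * X + 1) * (Y ^+ 2 + 2 * c * Y + 1)], and each factor is
    bounded below because [c] stays away from [- 1]. *)
Lemma light_edge_ineq c a X Y k : 0 <= k < 1 -> - k <= c -> 0 < X -> 0 < Y ->
  X * Y = a ^+ 2 -> Y <= X ->
  ((1 - k ^+ 2) * (X - Y)) ^+ 2 <=
  (X + Y + (1 + a ^+ 2) * c) ^+ 2 + ((1 - a ^+ 2)) ^+ 2 * (1 - c ^+ 2).
Proof.
move=> /andP[k0 k1] kc X0 Y0 XY YX; rewrite -XY.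
have -> : (X + Y + (1 + X * Y) * c) ^+ 2 + (1 - X * Y) ^+ 2 * (1 - c ^+ 2) =
  (X ^+ 2 + 2 * c * X + 1) * (Y ^+ 2 + 2 * c * Y + 1) by ring.
have P (Z : R) : 0 < Z ->
  (1 - k ^+ 2) * Z ^+ 2 <= Z ^+ 2 + 2 * c * Z + 1 /\
  (1 - k ^+ 2) <= Z ^+ 2 + 2 * c * Z + 1.
  move=> Z0; have E : 0 <= (c + k) * Z by rewrite mulr_ge0 ?(ltW Z0)//; lra.
  split; rewrite -subr_ge0.
    have -> : Z ^+ 2 + 2 * c * Z + 1 - (1 - k ^+ 2) * Z ^+ 2 =
     (1 - k * Z) ^+ 2 + 2 * ((c + k) * Z) by ring.
    by rewrite addr_ge0 ?sqr_ge0// mulr_ge0.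
  have -> : Z ^+ 2 + 2 * c * Z + 1 - (1 - k ^+ 2) =
     (Z - k) ^+ 2 + 2 * ((c + k) * Z) by ring.
  by rewrite addr_ge0 ?sqr_ge0// mulr_ge0.
have k2 : 0 <= 1 - k ^+ 2 by rewrite subr_ge0 expr_le1// ltW.
apply: (@le_trans _ _ (((1 - k ^+ 2) * X ^+ 2) * (1 - k ^+ 2))).
  have -> : (1 - k ^+ 2) * X ^+ 2 * (1 - k ^+ 2) = ((1 - k ^+ 2) * X) ^+ 2.
    by ring.
  have YX0 : 0 <= X - Y by rewrite subr_ge0.
  rewrite ler_sqr ?nnegrE ?(mulr_ge0 k2 YX0) ?(mulr_ge0 k2 (ltW X0))//.
  by rewrite ler_wpM2l// lerBlDr lerDl ltW.
have [[PX _] [_ PY]] := (P _ X0, P _ Y0).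
by apply: ler_pM => //; rewrite mulr_ge0// sqr_ge0.
Qed.

Lemma is_derive_angle T a y : 0 < T < pi -> 0 < a < 1 ->
  is_derive y 1 (fun z => angle T a (expR z))
   ((a / expR y - a * expR y) / ((1 - a ^+ 2) * sin T) /
     (1 + cot_angle T a (expR y) ^+ 2)).
Proof.
move=> T0pi a01.
have D := cot_angle_den_gt0 T0pi a01.
have e0 : expR y != 0 by rewrite gt_eqF ?expR_gt0.
have E : (fun z => angle T a (expR z)) =
  (fun z => pi / 2 - atan ((a * expR (- z) + a * expR z +
    (1 + a ^+ 2) * cos T) / ((1 - a ^+ 2) * sin T))).
  by apply/funext => z; rewrite /angle /acot /cot_angle expRN.
rewrite E.
apply: is_derive_eq.
rewrite /cot_angle expRN /GRing.scale /=.
set W := (1 + _ ^+ 2)^-1.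
have [s0 a20] : sin T != 0 /\ 1 - a ^+ 2 != 0.
  by move: D => /lt0r_neq0; rewrite mulf_eq0 negb_or => /andP[].
by field; rewrite s0 a20 e0.
Qed.

(** Let [b = expR y].  The derivative of the angle in [y] is at most
    [(1 - k ^+ 2)^-1] times its sine, by [light_edge_ineq], and the sine is at
    most the angle.  An estimate relative to the angle itself can be summed over
    any number of neighbours. *)
Lemma angle_light_edge T a b d k : 0 < T < pi -> 0 < a < 1 -> 0 < b < 1 ->
  0 <= k < 1 -> - k <= cos T -> 0 <= d ->
  (1 - d / (1 - k ^+ 2)) * angle T a b <= angle T a (b * expR (- d)).
Proof.
move=> T0pi a01 /andP[b0 b1] k01 kT d0.
have [/andP[a0 a1] /andP[k0 k1]] := (a01, k01).
have k2 : 0 < 1 - k ^+ 2 by rewrite subr_gt0 expr_lt1.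
pose f z := angle T a (expR z).
have fy : f (ln b) = angle T a b by rewrite /f lnK.
have fy' : f (ln b - d) = angle T a (b * expR (- d)).
  by rewrite /f expRD lnK.
have bd : ln b - d <= ln b by rewrite lerBlDr lerDl.
have [|z zI fE] := MVT_segment bd
    (fun y _ => is_derive_angle y T0pi a01).
  apply: derivable_within_continuous => y _.
  by have [] := is_derive_angle y T0pi a01.
move: fE; rewrite -/(f (ln b)) -/(f (ln b - d)) fy fy'.
have -> : ln b - (ln b - d) = d by ring.
have zb : z <= ln b by move: zI; rewrite in_itv/= => /andP[].
set b' := expR z.
have b'b : b' <= b by rewrite -[leRHS]lnK// ler_expR.
have b'0 : 0 < b' := expR_gt0 z.
set D := (1 - a ^+ 2) * sin T.
have D0 : 0 < D := cot_angle_den_gt0 T0pi a01.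
set q := cot_angle T a b'.
set r := Num.sqrt (1 + q ^+ 2).
have r2 : r ^+ 2 = 1 + q ^+ 2 by rewrite sqr_sqrtr// addr_ge0// sqr_ge0.
have r0 : 0 < r by rewrite sqrtr_gt0 ltr_pwDl// sqr_ge0.
(* The sine of an angle is at most the angle, which increases with b. *)
have rle : r^-1 <= angle T a b.
  rewrite -sin_acot; apply: le_trans (le_angle_r T0pi a01 b'0 b'b (ltW b1)).
  by apply: sin_le; rewrite ltW// acot_gt0.
have H : (a / b' - a * b') / D <= (1 - k ^+ 2)^-1 * r.
  rewrite ler_pdivrMr// -mulrA ler_pdivlMl//.
  have XY : a / b' * (a * b') = a ^+ 2 by field; rewrite gt_eqF.
  have X0 : 0 < a / b' by rewrite divr_gt0.
  have Y0 : 0 < a * b' by rewrite mulr_gt0.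
  have YX : a * b' <= a / b'.
    rewrite ler_pM2l// (@le_trans _ _ 1)//; first exact: le_trans (ltW b1).
    by rewrite invf_ge1// (le_trans b'b)// ltW.
  have := light_edge_ineq k01 kT X0 Y0 XY YX.
  have -> : (a / b' + a * b' + (1 + a ^+ 2) * cos T) ^+ 2 +
      (1 - a ^+ 2) ^+ 2 * (1 - cos T ^+ 2) = (r * D) ^+ 2.
    rewrite -sin2cos2 -exprMn -/D [RHS]exprMn r2 /q /cot_angle -/D.
    by field; rewrite !gt_eqF.
  rewrite ler_sqr// nnegrE; first by rewrite mulr_ge0 ?(ltW k2)// subr_ge0.
  by rewrite mulr_ge0 ?ltW.
move=> E; rewrite mulrBl mul1r lerBlDr -lerBlDl E.
have -> : d / (1 - k ^+ 2) * angle T a b = (1 - k ^+ 2)^-1 * angle T a b * d.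
  by ring.
rewrite ler_wpM2r// -r2 ler_pdivrMr ?exprn_gt0//.
apply: le_trans H _; rewrite -mulrA ler_pM2l ?invr_gt0// expr2 mulrA.
by rewrite ler_peMl ?(ltW r0)// -ler_pdivrMr// div1r.
Qed.

(** The sum of the two angles is [T] minus the area of the triangle.  With
    [Y = a * b], the tangent of the defect [pi - (angle T a b + angle T b a)] is
    [sin T * (1 - Y ^+ 2) / (- cos T * (1 + Y ^+ 2) - 2 * Y)], which is small when
    [sin T] is small compared with [(1 - Y) ^+ 2].  The defect is compared with
    [k] through the sign of the sine of their difference. *)
Lemma angle_heavy_edge T a b y k : 0 < T < pi -> 0 < a < 1 -> 0 < b < 1 ->
  a * b <= y -> y <= 1 -> 0 < k < pi -> cos T <= 0 ->
  3 * sin T <= sin k * (1 - y) ^+ 2 ->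
  pi - k <= angle T a b + angle T b a.
Proof.
move=> T0pi a01 b01 aby y1 k0pi c0 sk.
have [/andP[a0 a1] /andP[b0 b1]] := (a01, b01).
have := cot_angle_den_gt0 T0pi a01; have := cot_angle_den_gt0 T0pi b01.
have s0 : 0 < sin T by rewrite sin_gt0_pi.
have s1 : sin T <= 1 by apply: sin_le1.
have sk0 : 0 < sin k by rewrite sin_gt0_pi.
have ck1 : cos k <= 1 by apply: cos_le1.
have ss := cos2Dsin2 T.
have a2 : 0 < 1 - a ^+ 2 by rewrite subr_gt0 expr_lt1// ltW.
have b2 : 0 < 1 - b ^+ 2 by rewrite subr_gt0 expr_lt1// ltW.
set q1 := cot_angle T a b; set q2 := cot_angle T b a.
rewrite /angle /acot -/q1 -/q2 => D2 D1.
suff : atan q1 + atan q2 <= k by lra.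
rewrite leNgt; apply/negP => kq.
have : 0 < sin (atan q1 + atan q2 - k).
  by apply: sin_gt0_pi; have := atan_ltpi2 q1; have := atan_ltpi2 q2; lra.
set r1 := Num.sqrt (1 + q1 ^+ 2); set r2 := Num.sqrt (1 + q2 ^+ 2).
have r10 : 0 < r1 by rewrite sqrtr_gt0 ltr_pwDl// sqr_ge0.
have r20 : 0 < r2 by rewrite sqrtr_gt0 ltr_pwDl// sqr_ge0.
rewrite sinB sinD cosD !sin_atan !cos_atan -/r1 -/r2.
set Y := a * b.
have Y0 : 0 < Y by rewrite mulr_gt0.
(* M = a / b + b / a + 2 cos T, written so that positivity is visible. *)
set M := ((a - b) ^+ 2 / Y + 2 * (1 + cos T)).
have M0 : 0 < M.
  by rewrite ltr_wpDl ?divr_ge0 ?sqr_ge0 ?(ltW Y0)// mulr_gt0// -ltrBlDl sub0r cos_gtN1.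
have Y1 : Y < 1 by rewrite mulr_ilt1 ?ltW.
have E1 : q1 + q2 = M * (sin T * (1 - Y ^+ 2)) /
    (((1 - a ^+ 2) * sin T) * ((1 - b ^+ 2) * sin T)).
  rewrite /q1 /q2 /cot_angle /M /Y.
  by field; rewrite !gt_eqF.
have E2 : 1 - q1 * q2 = M * (- cos T * (1 + Y ^+ 2) - 2 * Y) /
    (((1 - a ^+ 2) * sin T) * ((1 - b ^+ 2) * sin T)).
  apply: (canRL (mulfK _)); first by rewrite gt_eqF// mulr_gt0.
  rewrite mulrBl mul1r {1}[(1 - a ^+ 2) * sin T * _]mulrACA -expr2.
  have -> : sin T ^+ 2 = 1 - cos T ^+ 2 by rewrite -ss; ring.
  rewrite mulrACA !divfK ?gt_eqF// /M /Y; field.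
  by rewrite !gt_eqF.
have -> : (q1 / r1 / r2 + r1^-1 * (q2 / r2)) * cos k -
    (r1^-1 / r2 - q1 / r1 * (q2 / r2)) * sin k =
  ((q1 + q2) * cos k - (1 - q1 * q2) * sin k) / (r1 * r2).
  by field; rewrite !gt_eqF.
rewrite pmulr_lgt0 ?invr_gt0 ?mulr_gt0// E1 E2.
rewrite mulrAC [X in _ - X]mulrAC -mulrBl pmulr_lgt0 ?invr_gt0 ?mulr_gt0//.
rewrite -!mulrA -mulrBr pmulr_rgt0//; apply/negP; rewrite -leNgt subr_le0.
have c1 : 1 - sin T <= - cos T.
  have sT2 : (1 - sin T) ^+ 2 <= (- cos T) ^+ 2 by nra.
  by move: sT2; rewrite ler_sqr// nnegrE; lra.
have Y2 : 0 <= Y ^+ 2 by rewrite sqr_ge0.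
have Y21 : Y ^+ 2 <= 1 by rewrite expr_le1 ?ltW.
apply: (@le_trans _ _ (sin T)).
  rewrite ler_piMr ?(ltW s0)//; nra.
have yY : (1 - y) ^+ 2 <= (1 - Y) ^+ 2.
  by rewrite ler_sqr ?nnegrE; rewrite /Y; lra.
have : sin k * (1 - y) ^+ 2 <= sin k * (1 - Y) ^+ 2 by rewrite ler_pM2l.
have sk1 := sin_le1 k.
have cY : (1 - sin T) * (1 + Y ^+ 2) <= - cos T * (1 + Y ^+ 2).
  by rewrite ler_wpM2r//; lra.
have sY : sin T * Y ^+ 2 <= sin T by rewrite ler_piMr// ltW.
have : sin k * ((1 - Y) ^+ 2 - 2 * sin T) <=
    sin k * (- cos T * (1 + Y ^+ 2) - 2 * Y) by rewrite ler_pM2l//; lra.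
have : sin k * sin T <= sin T by rewrite ler_piMl// ltW.
lra.
Qed.

Lemma atan_near_pihalf e : 0 < e ->
  exists2 Q : R, 1 <= Q & forall q, Q <= q -> acot q <= e.
Proof.
move=> e0; have /cvgrPdist_le/(_ _ e0)[Q [_ HQ]] := @cvgy_atan R.
exists (Num.max 1 (Q + 1)); first by rewrite le_max lexx.
move=> q Qq; apply: le_trans (ler_norm _) (HQ _ _).
by apply: lt_le_trans Qq; rewrite lt_max ltrDl ltr01 orbT.
Qed.

(** Since [2 * a <= a / b + a * b], the numerator of [cot_angle] is at least
    [2 * a + (1 + a ^+ 2) * cos T] for all [b]; it tends to [2 * (1 + cos T) > 0]
    as [a] tends to 1, while the denominator tends to 0. *)
Lemma angle_vanishing T e : 0 < T < pi -> 0 < e -> exists2 a0, 0 < a0 < 1 &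
  forall a b, a0 <= a -> a < 1 -> 0 < b -> angle T a b <= e.
Proof.
move=> T0pi e0; have [Q Q1 HQ] := atan_near_pihalf e0.
have c1 := cos_gtN1 T0pi; have cl1 := cos_le1 T.
have Q0 : 0 < 2 * Q + 1 by lra.
(* The numerator of the cotangent is at least (1 + cos T) - (1 - a), and the
   denominator at most 2 (1 - a). *)
exists (1 - (1 + cos T) / (2 * Q + 1)).
  rewrite subr_gt0 ltr_pdivrMr// mul1r ltrBlDr ltrDl divr_gt0//; lra.
move=> a b a0a a1 b0; apply: HQ.
have a0 : 0 < a.
  by apply: lt_le_trans a0a; rewrite subr_gt0 ltr_pdivrMr//; lra.
rewrite ler_pdivlMr; last by rewrite cot_angle_den_gt0// a0.
have ab : 2 * a <= a / b + a * b.
  rewrite -subr_ge0.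
  have -> : a / b + a * b - 2 * a = a * (1 - b) ^+ 2 / b.
    by field; rewrite gt_eqF.
  by rewrite divr_ge0 ?(ltW b0)// mulr_ge0 ?sqr_ge0 ?ltW.
have : (1 - a) * (2 * Q + 1) <= 1 + cos T.
  by rewrite -ler_pdivlMr//; lra.
have := sin_le1 T; have := sin_gt0_pi T0pi => s0 s1 aQ.
have : Q * ((1 - a ^+ 2) * sin T) <= Q * (2 * (1 - a)).
  rewrite ler_wpM2l//; first by lra.
  by apply: (@le_trans _ _ (1 - a ^+ 2)); [rewrite ler_piMr//; nra|nra].
nra.
Qed.

Lemma cvg_angle (X : Type) (F : set_system X) {FF : Filter F} T (f g : X -> R) a b :
  0 < T < pi -> 0 < a < 1 -> 0 < b ->
  f x @[x --> F] --> a -> g x @[x --> F] --> b ->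
  angle T (f x) (g x) @[x --> F] --> angle T a b.
Proof.
move=> T0pi a01 b0 fa gb; have D := cot_angle_den_gt0 T0pi a01.
rewrite /angle /acot; apply: cvgB; first exact: cvg_cst.
apply: continuous_cvg; first exact: continuous_atan.
rewrite /cot_angle.
apply: cvgM; last first.
  apply: cvgV; first by rewrite gt_eqF.
  by apply: cvgM; [apply: cvgB; [exact: cvg_cst|exact: cvgM]|exact: cvg_cst].
apply: cvgD; last first.
  by apply: cvgM; [apply: cvgD; [exact: cvg_cst|exact: cvgM]|exact: cvg_cst].
apply: cvgD; last exact: cvgM.
by apply: cvgM => //; apply: cvgV => //; rewrite gt_eqF.
Qed.
End Angle.

(** * Hyperbolic trigonometry of the kites *)

Section Bridge.
Variable R : realType.
Implicit Types T r s P : R.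

Lemma cosh_gt0 r : 0 < cosh r.
Proof. by rewrite divr_gt0// addr_gt0 ?expR_gt0. Qed.

Lemma sinh_gt0 r : 0 < r -> 0 < sinh r.
Proof. by move=> r0; rewrite divr_gt0// subr_gt0 ltr_expR; lra. Qed.

Lemma sinh_lt_cosh r : sinh r < cosh r.
Proof. rewrite ltr_pM2r//; have := expR_gt0 (- r); lra. Qed.

Lemma cosh2sinh2 r : cosh r ^+ 2 = 1 + sinh r ^+ 2.
Proof.
rewrite /cosh /sinh expRN; have e0 : expR r != 0 by rewrite gt_eqF ?expR_gt0.
by field.
Qed.

Lemma expR_arcosh P : 1 < P -> expR (arcosh P) = P + Num.sqrt (P ^+ 2 - 1).
Proof. by move=> P1; rewrite lnK// posrE ltr_wpDr ?sqrtr_ge0//; lra. Qed.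

Lemma expRN_arcosh P : 1 < P -> expR (- arcosh P) = P - Num.sqrt (P ^+ 2 - 1).
Proof.
move=> P1; have P2 : Num.sqrt (P ^+ 2 - 1) ^+ 2 = P ^+ 2 - 1.
  by rewrite sqr_sqrtr// subr_ge0 exprn_ege1 ?ltW.
have S0 : 0 < P + Num.sqrt (P ^+ 2 - 1) by rewrite ltr_wpDr ?sqrtr_ge0//; lra.
rewrite expRN expR_arcosh//; apply: (mulfI (lt0r_neq0 S0)).
by rewrite divff ?gt_eqF// mulrC -subr_sqr P2; ring.
Qed.

Lemma cosh_arcosh P : 1 < P -> cosh (arcosh P) = P.
Proof. by move=> P1; rewrite /cosh expR_arcosh// expRN_arcosh//; field. Qed.

Lemma sinh_arcosh P : 1 < P -> sinh (arcosh P) = Num.sqrt (P ^+ 2 - 1).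
Proof. by move=> P1; rewrite /sinh expR_arcosh// expRN_arcosh//; field. Qed.

Definition tanh_half r : R := (expR r - 1) / (expR r + 1).

Lemma tanh_half_itv r : 0 < r -> 0 < tanh_half r < 1.
Proof.
move=> r0; have e1 : 1 < expR r by rewrite -expR0 ltr_expR.
rewrite divr_gt0 ?ltr_pdivrMr; lra.
Qed.

(** By the two laws of cosines, the cosine of the angle is
    [N / Num.sqrt (N ^+ 2 + D ^+ 2)], with [N] and [D] as in the proof, so its
    cotangent is [N / D]. *)
Lemma inner_angleE r s T : 0 < r -> 0 < s -> 0 < T < pi ->
  inner_angle r s T = angle T (tanh_half r) (tanh_half s).
Proof.
move=> r0 s0 T0pi.
have sT : 0 < sin T by rewrite sin_gt0_pi.
have cT : - 1 < cos T by exact: cos_gtN1.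
have [cr sr] := (cosh_gt0 r, sinh_gt0 r0).
have [cs ss] := (cosh_gt0 s, sinh_gt0 s0).
have er := cosh2sinh2 r; have es := cosh2sinh2 s.
set P := cosh r * cosh s + sinh r * sinh s * cos T.
set N := sinh r * cosh s + cosh r * sinh s * cos T.
set D := sinh s * sin T.
have D0 : 0 < D by rewrite mulr_gt0.
have PE : P ^+ 2 - 1 = N ^+ 2 + D ^+ 2.
  rewrite /P /N /D [X in _ = _ + X]exprMn sin2cos2.
  rewrite -[1](_ : (cosh r ^+ 2 - sinh r ^+ 2) * (cosh s ^+ 2 - sinh s ^+ 2) = 1).
    by ring: er es.
  by rewrite er es; ring.
have P1 : 1 < P.
  have : 0 < P.
    have : sinh r * sinh s < cosh r * cosh s.
      by apply: ltr_pM; rewrite ?sinh_lt_cosh// ltW.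
    have : 0 < sinh r * sinh s * (1 + cos T).
      rewrite mulr_gt0//; last by lra.
      by rewrite mulr_gt0.
    by rewrite /P; lra.
  have : 1 < P ^+ 2 by rewrite -subr_gt0 PE ltr_wpDl ?sqr_ge0// exprn_gt0.
  by move=> P2 P0; rewrite -(ltr_pXn2r (ltn0Sn 1)) ?nnegrE ?expr1n ?(ltW P0).
have qE : cot_angle T (tanh_half r) (tanh_half s) = N / D.
  rewrite /cot_angle /N /D /tanh_half /cosh /sinh !expRN.
  have : 1 < expR r by rewrite -expR0 ltr_expR.
  have : 1 < expR s by rewrite -expR0 ltr_expR.
  move: (expR r) (expR s) => e f f1 e1.
  field.
  have [ff ee] : 1 < f * f /\ 0 < (e + 1) ^+ 2 - (e - 1) ^+ 2.
    by split; [rewrite mulr_cp1// ?ltW// (lt_trans ltr01)|lra].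
  by rewrite !gt_eqF//; lra.
rewrite /inner_angle /hyp_angle /edge_length -/P cosh_arcosh// sinh_arcosh//.
rewrite /angle qE -[RHS]cosK; last first.
  by rewrite in_itv/= (ltW (acot_gt0 _)) (ltW (acot_ltpi _)).
congr acos; rewrite cos_acot.
have W0 : 0 < Num.sqrt (1 + (N / D) ^+ 2) by rewrite sqrtr_gt0 ltr_pwDl// sqr_ge0.
have -> : Num.sqrt (P ^+ 2 - 1) = D * Num.sqrt (1 + (N / D) ^+ 2).
  rewrite PE -[X in X * _](@gtr0_norm _ D)// -sqrtr_sqr -sqrtrM ?sqr_ge0//.
  by congr Num.sqrt; field; rewrite gt_eqF.
have -> : cosh r * P - cosh s = sinh r * N.
  rewrite /P /N; transitivity (cosh s * (cosh r ^+ 2 - 1) + sinh r * cosh r * sinh s * cos T).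
    by ring.
  by rewrite er; ring.
by field; rewrite !gt_eqF.
Qed.

Lemma is_derive_ln_tanh_half r : 0 < r ->
  is_derive r 1 (fun x => ln (tanh_half x)) (sinh r)^-1.
Proof.
move=> r0; have /andP[t0 _] := tanh_half_itv r0.
have e1 : 1 < expR r by rewrite -expR0 ltr_expR.
have d0 : expR r + 1 != 0 by rewrite gt_eqF//; lra.
have Dt : is_derive r 1 tanh_half (2 * expR r / (expR r + 1) ^+ 2).
  rewrite (_ : tanh_half = (fun x => 1 - 2 * (expR x + 1)^-1)); last first.
    apply/funext => x; rewrite /tanh_half; field.
    by rewrite gt_eqF// addr_gt0 ?expR_gt0.
  apply: is_derive_eq; rewrite /GRing.scale/=; field.
  by rewrite d0.
have Dl := is_derive1_ln t0.
apply: (is_derive_eq (is_derive1_comp Dl Dt)).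
rewrite /GRing.scale/= /sinh expRN /tanh_half; field.
have ee : 1 < expR r * expR r by rewrite mulr_cp1// ?ltW// (lt_trans ltr01).
by rewrite !gt_eqF//; lra.
Qed.
End Bridge.

(** * Curvature on locally finite graphs *)

Section SeqSums.
Variables (R : realType) (V : eqType).

Lemma ler_sum_uniq_sub (s1 s2 : seq V) (f : V -> R) : uniq s1 -> uniq s2 ->
  (forall i, 0 <= f i) ->
  \sum_(i <- s1 | i \in s2) f i <= \sum_(i <- s2) f i.
Proof.
move=> u1 u2 f0; rewrite -big_filter.
rewrite (perm_big [seq i <- s2 | i \in s1]); last first.
  apply: uniq_perm; rewrite ?filter_uniq// => i.
  by rewrite !mem_filter andbC.
by rewrite big_filter big_mkcond; apply: ler_sum => i _; case: ifP.
Qed.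

Lemma is_derive_seq_sum (s : seq V) (f df : V -> R -> R) (t : R) :
  (forall i, is_derive t 1 (f i) (df i t)) ->
  is_derive t 1 (fun x : R => \sum_(i <- s) f i x) (\sum_(i <- s) df i t).
Proof.
move=> fd; elim: s => [|i s IH].
  rewrite big_nil (_ : (fun _ => _) = cst 0); first exact: is_derive_cst.
  by apply/funext => x; rewrite big_nil.
rewrite big_cons (_ : (fun _ => _) = f i \+ (fun x => \sum_(j <- s) f j x)).
  exact: is_deriveD.
by apply/funext => x; rewrite big_cons.
Qed.

Lemma continuous_seq_sum (s : seq V) (f : V -> R -> R) :
  (forall i, continuous (f i)) -> continuous (fun x : R => \sum_(i <- s) f i x).
Proof.
move=> fc; elim: s => [|i s IH].
  rewrite (_ : (fun _ => _) = cst 0); first exact: cst_continuous.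
  by apply/funext => x; rewrite big_nil.
rewrite (_ : (fun _ => _) = f i \+ (fun x => \sum_(j <- s) f j x)).
  by move=> x; apply: cvgD; [exact: fc|exact: IH].
by apply/funext => x; rewrite big_cons.
Qed.

End SeqSums.

Section Patterns.
Variables (R : realType) (V : eqType) (nbr : V -> seq V) (Theta : V -> V -> R).
Hypothesis nbr_uniq : forall i, uniq (nbr i).
Hypothesis nbr_sym : forall i j, j \in nbr i -> i \in nbr j.
Hypothesis ThetaP : forall i j, j \in nbr i -> Theta i j = Theta j i /\ 0 < Theta i j < pi.
Implicit Types (x y : V -> R) (i j : V) (k : R).

Definition edge_angle x i j := angle (Theta i j) (expR (x i)) (expR (x j)).

(** The curvature in the coordinates [ln (tanh (r / 2))]. *)
Definition log_curvature x i := 2 * pi - 2 * \sum_(j <- nbr i) edge_angle x i j.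

Definition heavy k i j := (j \in nbr i) && (cos (Theta i j) < - k).

Lemma log_curvature_le x i : log_curvature x i <= 2 * pi.
Proof.
rewrite gerBl mulr_ge0// sumr_ge0// => j _.
by rewrite ltW// angle_gt0.
Qed.

(** The comparison at an almost largest drop [D]: [d] is the excess by which the
    drop at a neighbour may exceed [D], and the conclusion does not depend on
    the number of neighbours.  The angles of [x] sum to at least [pi]; shifting
    all of [x] by [- D] increases them; and lowering the light neighbours further
    by [d] loses at most the fraction [d / (1 - k ^+ 2)] of each. *)
Lemma log_curvature_drop x y i k D d :
  (forall j, x j < 0) -> (forall j, y j < 0) -> 0 <= k < 1 ->
  0 <= D -> 0 <= d <= 1 - k ^+ 2 ->
  y i = x i - D ->
  (forall j, x j - D - d <= y j) ->
  (forall j, heavy k i j -> x j - D <= y j) ->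
  log_curvature x i <= 0 -> log_curvature y i <= 2 * pi * (d / (1 - k ^+ 2)).
Proof.
move=> x0 y0 k01 D0 /andP[d0 dk] yi yj yh Kx.
have /andP[k0 k1] := k01.
have k2 : 0 < 1 - k ^+ 2 by rewrite subr_gt0 expr_lt1.
set c := d / (1 - k ^+ 2).
have c1 : c <= 1 by rewrite ler_pdivrMr// mul1r.
have c0 : 0 <= c by rewrite divr_ge0// ltW.
suff H : (1 - c) * \sum_(j <- nbr i) edge_angle x i j <=
    \sum_(j <- nbr i) edge_angle y i j.
  have sx : pi <= \sum_(j <- nbr i) edge_angle x i j.
    by move: Kx; rewrite /log_curvature; lra.
  have : (1 - c) * pi <= (1 - c) * \sum_(j <- nbr i) edge_angle x i j.
    by rewrite ler_wpM2l// subr_ge0.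
  by rewrite /log_curvature; lra.
rewrite mulr_sumr big_seq [leRHS]big_seq; apply: ler_sum => j ij.
have [_ T0pi] := ThetaP ij.
have l01 : 0 < expR (- D) <= 1 by rewrite expR_gt0/= expR_le1 oppr_le0.
have ai := expR_neg_itv (x0 i); have aj := expR_neg_itv (x0 j).
have yiE : expR (y i) = expR (- D) * expR (x i) by rewrite yi addrC expRD.
have yi01 := expR_neg_itv (y0 i).
have eD : expR (x j - D) = expR (- D) * expR (x j) by rewrite addrC expRD.
have scaled : edge_angle x i j <=
    angle (Theta i j) (expR (y i)) (expR (x j - D)).
  by rewrite yiE eD; exact: le_angle_scale.
have y1 := ltW (proj2 (andP (expR_neg_itv (y0 j)))).
have [hij|lij] := boolP (heavy k i j).
  apply: (@le_trans _ _ (edge_angle x i j)).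
    by rewrite ler_piMl ?(ltW (angle_gt0 _ _ _))//; lra.
  apply: le_trans scaled _; apply: le_angle_r => //; first exact: expR_gt0.
  by rewrite ler_expR yh.
have kT : - k <= cos (Theta i j) by move: lij; rewrite /heavy ij/= -leNgt.
apply: le_trans (ler_wpM2l _ scaled) _; first by rewrite subr_ge0.
have aD : 0 < expR (x j - D) < 1.
  by apply: expR_neg_itv; have := x0 j; lra.
apply: le_trans (angle_light_edge T0pi yi01 aD k01 kT d0) _.
apply: le_angle_r => //; first by rewrite mulr_gt0 ?expR_gt0.
by rewrite -expRD ler_expR yj.
Qed.

(** Each edge of the chain contributes its two angles, one at each end; they occur
    as different terms of the sum because the vertices are distinct. *)
Lemma chain_angles x k e v p : uniq (v :: p) -> path (heavy k) v p ->
  (forall i j, i \in v :: p -> j \in v :: p -> heavy k i j ->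
     pi - e <= edge_angle x i j + edge_angle x j i) ->
  (size p)%:R * (pi - e) <=
    \sum_(i <- v :: p) \sum_(j <- v :: p | j \in nbr i) edge_angle x i j.
Proof.
elim: p v => [|w p IH] v.
  by rewrite mul0r sumr_ge0// => i _; rewrite sumr_ge0// => j _; rewrite ltW// angle_gt0.
move=> /= /andP[vwp uwp] /andP[vw pwp] H.
have split_v : \sum_(i <- w :: p) \sum_(j <- v :: w :: p | j \in nbr i) edge_angle x i j =
  \sum_(i <- w :: p) (if v \in nbr i then edge_angle x i v else 0) +
  \sum_(i <- w :: p) \sum_(j <- w :: p | j \in nbr i) edge_angle x i j.
  rewrite -big_split/=; apply: eq_bigr => i _.
  by rewrite big_cons; case: ifP => //; rewrite add0r.
have B : (size p)%:R * (pi - e) <=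
    \sum_(i <- w :: p) \sum_(j <- w :: p | j \in nbr i) edge_angle x i j.
  by apply: IH => // i j iwp jwp; apply: H; rewrite inE ?iwp ?jwp ?orbT//.
have A : pi - e <= \sum_(j <- v :: w :: p | j \in nbr v) edge_angle x v j +
    \sum_(i <- w :: p) (if v \in nbr i then edge_angle x i v else 0).
  have /andP[wv _] := vw.
  apply: (le_trans (H v w _ _ vw)); rewrite ?inE ?eqxx ?orbT//.
  have nn (s : seq V) : 0 <= \sum_(j <- s | j \in nbr v) edge_angle x v j.
    by rewrite sumr_ge0// => j _; rewrite ltW// angle_gt0.
  apply: lerD.
    rewrite big_cons; case: ifP => _; rewrite big_cons wv.
      by rewrite addrCA lerDl addr_ge0// ltW// angle_gt0.
    by rewrite lerDl.
  rewrite big_cons nbr_sym// lerDl sumr_ge0// => i _.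
  by case: ifP => // _; rewrite ltW// angle_gt0.
rewrite big_cons split_v -natr1; lra.
Qed.

Lemma chain_curvature x k e v p : uniq (v :: p) -> path (heavy k) v p ->
  (forall i j, i \in v :: p -> j \in v :: p -> heavy k i j ->
     pi - e <= edge_angle x i j + edge_angle x j i) ->
  \sum_(i <- v :: p) log_curvature x i <= 2 * pi + 2 * (size p)%:R * e.
Proof.
move=> uvp hvp H; have := chain_angles uvp hvp H.
have : \sum_(i <- v :: p) \sum_(j <- v :: p | j \in nbr i) edge_angle x i j <=
  \sum_(i <- v :: p) \sum_(j <- nbr i) edge_angle x i j.
  apply: ler_sum => i _; apply: ler_sum_uniq_sub => // j.
  by rewrite ltW// angle_gt0.
have -> : \sum_(i <- v :: p) log_curvature x i = 2 * pi * (size p).+1%:R -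
    2 * \sum_(i <- v :: p) \sum_(j <- nbr i) edge_angle x i j.
  rewrite /log_curvature sumrB mulr_sumr big_const_seq count_predT iter_addr.
  by rewrite addr0 [in RHS]mulr_natr.
rewrite -natr1; lra.
Qed.

(** The bounds on [x i] and [x j] keep the triangle small, so that its area
    vanishes as the intersection angle tends to [pi]. *)
Lemma heavy_edge_angles x k e b i j : (forall i, x i < 0) ->
  0 < e < pi -> 0 <= b -> 0 <= k ->
  9 * (1 - k ^+ 2) <= (sin e * (1 - expR (- b)) ^+ 2) ^+ 2 ->
  x i <= - (b / 2) -> x j <= - (b / 2) -> heavy k i j ->
  pi - e <= edge_angle x i j + edge_angle x j i.
Proof.
move=> x0 e0pi b0 k0 ke xi xj /andP[ij cT].
have [TE T0pi] := ThetaP ij.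
rewrite /edge_angle -TE; apply: (@angle_heavy_edge _ _ _ _ (expR (- b))) => //.
- exact: expR_neg_itv.
- exact: expR_neg_itv.
- by rewrite -expRD ler_expR; lra.
- by rewrite expR_le1 oppr_le0.
- lra.
have s0 := sin_gt0_pi T0pi.
have := sin_gt0_pi e0pi => se.
rewrite -ler_sqr ?nnegrE; last 2 first.
- by rewrite mulr_ge0// ltW.
- by rewrite mulr_ge0 ?sqr_ge0// ltW.
apply: le_trans ke; rewrite exprMn sin2cos2.
have : k ^+ 2 <= cos (Theta i j) ^+ 2.
  by rewrite -[leRHS]sqrrN ler_sqr ?nnegrE; lra.
lra.
Qed.

End Patterns.

(** * The maximum principle for the flow *)

Section Flow.
Variables (R : realType) (V : eqType) (nbr : V -> seq V) (Theta : V -> V -> R).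
Hypothesis nbr_uniq : forall i, uniq (nbr i).
Hypothesis nbr_sym : forall i j, j \in nbr i -> i \in nbr j.
Hypothesis ThetaP : forall i j, j \in nbr i -> Theta i j = Theta j i /\ 0 < Theta i j < pi.
Variable u : R -> V -> R.
Hypothesis u_lt0 : forall t i, u t i < 0.
Hypothesis u_continuous : forall i, continuous (u ^~ i).
Local Notation K := (log_curvature nbr Theta).
Hypothesis u_flow : forall (t : R) i, 0 < t -> is_derive t 1 (u ^~ i) (- K (u t) i).
Hypothesis K0 : forall i, K (u 0) i <= 0.

(** Angles are positive, so the curvature never exceeds [2 * pi].  There is no
    such bound on the speed of increase of [u]. *)
Lemma flow_drop_le i (s t : R) : 0 <= s -> s <= t -> u s i - u t i <= 2 * pi * (t - s).
Proof.
move=> s0 st; have := @increment_ge R (u ^~ i) (fun x => - K (u x) i) s t (- (2 * pi)) st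
  (@u_continuous i).
have -> : - (2 * pi) * (t - s) <= u t i - u s i = (u s i - u t i <= 2 * pi * (t - s)).
  by rewrite mulNr lerNl opprB.
apply => x sx xt; first by apply: u_flow; lra.
by rewrite lerN2 log_curvature_le.
Qed.

Lemma curvature_at_max i (s : R) : 0 <= s -> (forall x, 0 <= x -> x < s -> u x i <= u s i) ->
  K (u s) i <= 0.
Proof.
rewrite le_eqVlt => /predU1P[<- _|s0 H]; first exact: K0.
by rewrite -oppr_ge0; apply: (derive_ge0_left_max s0 (u_flow i s0)).
Qed.

Section Step.
Variables b g : R.

Definition drops_le (T : R) := forall i (s t : R), 0 <= s -> s <= t -> t <= T ->
   u s i - u t i - g * t <= b.

(** A penalized drop above [b] that ends shortly after [sigma], although none
    ends before [sigma], must be nearly attained at [sigma].  Comparison with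
    the drops that end at [sigma - h'] then shows that [u] has decreased at
    average speed at least [g / 2] between [sigma - h'] and [sigma].  Moreover
    [u] is below [- (b / 2)] there: it starts from a negative value and loses
    at least that much. *)
Lemma late_drop (h h' sigma : R) i (s t : R) :
  0 < b -> 0 < g -> 0 <= sigma -> 0 < h -> 0 < h' ->
  2 * pi * (h + h') <= b / 2 ->
  4 * pi * h <= g * h' -> drops_le sigma ->
  0 <= s -> s <= t -> sigma <= t -> t <= sigma + h -> b < u s i - u t i - g * t ->
  [/\ 0 <= sigma - h', g * h' / 2 <= u (sigma - h') i - u sigma i &
   forall x : R, sigma - h' <= x -> x <= sigma -> u x i <= - (b / 2)].
Proof.
move=> b0 g0 S0 h0 h'0 hh hg HS s0 st St tS ust.
have p0 := @pi_gt0 R.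
have pp0 : 0 < 2 * pi :> R by lra.
have ph : 2 * pi * h <= b / 2.
  by apply: le_trans hh; rewrite ler_pM2l//; lra.
have gt : g * sigma <= g * t by rewrite ler_pM2l.
have gt0 : 0 <= g * sigma by rewrite mulr_ge0// ltW.
have sS : s <= sigma.
  case: leP => // Ss; suff : b <= 0 by rewrite leNgt b0.
  have := flow_drop_le i s0 st.
  have : 2 * pi * (t - s) <= 2 * pi * h by rewrite ler_pM2l//; lra.
  lra.
have dS : b + g * sigma - 2 * pi * h <= u s i - u sigma i.
  have := flow_drop_le i S0 St.
  have : 2 * pi * (t - sigma) <= 2 * pi * h by rewrite ler_pM2l//; lra.
  lra.
have sS' : s <= sigma - h'.
  case: leP => // Ss; suff : b <= 0 by rewrite leNgt b0.
  have := flow_drop_le i s0 sS.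
  have : 2 * pi * (sigma - s) <= 2 * pi * h' by rewrite ler_pM2l//; lra.
  lra.
split; first exact: le_trans sS'.
  have := HS i s (sigma - h') s0 sS'; rewrite lerBlDr lerDl ltW// => /(_ isT); lra.
move=> x Sx xS; have x0 : 0 <= x by lra.
have := flow_drop_le i x0 xS; have := u_lt0 s i.
have : 2 * pi * (sigma - x) <= 2 * pi * h' by rewrite ler_pM2l//; lra.
lra.
Qed.

(** All vertices of the chain lose at least [g * h' / 2] over the same time
    window, whereas by [chain_curvature] the sum of [u] over the chain decreases
    at speed at most [2 * pi + 2 * (size p)%:R * (g / 8)]. *)
Lemma no_late_chain (k h' sigma : R) v p :
  0 < b -> 0 < g <= 1 -> 0 <= k -> 0 < h' -> 0 <= sigma - h' ->
  9 * (1 - k ^+ 2) <= (sin (g / 8) * (1 - expR (- b)) ^+ 2) ^+ 2 ->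
  uniq (v :: p) -> path (heavy nbr Theta k) v p ->
  (forall i, i \in v :: p -> g * h' / 2 <= u (sigma - h') i - u sigma i /\
   forall x : R, sigma - h' <= x -> x <= sigma -> u x i <= - (b / 2)) ->
  (size p)%:R * g < 8 * pi.
Proof.
move=> b0 /andP[g0 g1] k0 h'0 S0 kg uvp hvp H.
have p2 := pi_ge2 R.
pose f x := \sum_(i <- v :: p) u x i.
pose L := 2 * pi + 2 * (size p)%:R * (g / 8).
have fd (x : R) : 0 < x -> is_derive x 1 f (\sum_(i <- v :: p) - K (u x) i).
  by move=> x0; apply: (@is_derive_seq_sum _ _ _ (fun i t => u t i)
    (fun i t => - K (u t) i)) => i; apply: u_flow.
have fc : continuous f by apply: continuous_seq_sum.
have SS : sigma - h' <= sigma by lra.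
have /(_ (- L)) := increment_ge SS fc (fun x Sx _ => fd x (le_lt_trans S0 Sx)).
have KL (x : R) : sigma - h' < x -> x < sigma -> - L <= \sum_(i <- v :: p) - K (u x) i.
  move=> Sx xS; rewrite sumrN lerN2; apply: (chain_curvature _ _ uvp hvp) => //.
  move=> i j /H[_ ui] /H[_ uj]; apply: (@heavy_edge_angles _ _ _ _ ThetaP _ k _ b) => //.
  - by lra.
  - exact: ltW.
  - by apply: ui; exact: ltW.
  - by apply: uj; exact: ltW.
move=> /(_ KL).
have : f sigma - f (sigma - h') <= - ((size p).+1%:R * (g * h' / 2)).
  rewrite -opprB lerN2 /f -sumrB.
  have -> : (size p).+1%:R * (g * h' / 2) = \sum_(i <- v :: p) (g * h' / 2).
    by rewrite big_const_seq count_predT iter_addr addr0 mulr_natl.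
  by rewrite big_seq [leRHS]big_seq; apply: ler_sum => i /H[].
move=> fL Lf.
have : h' * ((size p).+1%:R * (g / 2)) <= h' * L.
  move: (le_trans Lf fL); rewrite mulNr lerN2; lra.
rewrite ler_pM2l// /L -natr1; lra.
Qed.

(** The maximum principle over a time step whose length depends on [b] and [g]
    only.  If it fails, let [m j] be the largest penalized drop at [j] up to time
    [sigma + h].  Every vertex with [m] close to the supremum has a heavy
    neighbour with a larger [m], for otherwise [log_curvature_drop] contradicts
    [g <= K].  This produces heavy chains of any length, against
    [no_late_chain]. *)
Lemma drops_le_step : 0 < b -> 0 < g <= 1 -> exists2 h, 0 < h &
  forall sigma, 0 <= sigma -> drops_le sigma -> drops_le (sigma + h).
Proof.
move=> b0 g01; have /andP[g0 g1] := g01; have p2 := pi_ge2 R.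
(* Heavy means that sin Theta < s0 and cos Theta < 0: this is the threshold at
   which heavy_edge_angles holds with e = g / 8. *)
pose y0 := expR (- b); pose s0 := sin (g / 8) * (1 - y0) ^+ 2 / 3.
have y01 : 0 < y0 < 1 by rewrite /y0 expR_gt0/= expR_lt1; lra.
have sg0 : 0 < sin (g / 8) by apply: sin_gt0_pi; lra.
have sg1 := sin_le1 (g / 8).
have s00 : 0 < s0 by rewrite /s0 divr_gt0// mulr_gt0// exprn_gt0//; lra.
have s01 : s0 < 1.
  have : (1 - y0) ^+ 2 <= 1 by rewrite expr_le1//; lra.
  by rewrite /s0; nra.
pose k := Num.sqrt (1 - s0 ^+ 2).
have k2 : k ^+ 2 = 1 - s0 ^+ 2.
  by rewrite sqr_sqrtr// subr_ge0 expr_le1// ltW.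
have k0 : 0 <= k by rewrite sqrtr_ge0.
have k1 : k < 1.
  by rewrite -[ltRHS]sqrtr1 ltr_sqrt// ltrBlDr ltrDl exprn_gt0.
have kE : 1 - k ^+ 2 = s0 ^+ 2 by rewrite k2; ring.
have kg : 9 * (1 - k ^+ 2) <= (sin (g / 8) * (1 - expR (- b)) ^+ 2) ^+ 2.
  by rewrite kE /s0 -/y0 le_eqVlt; apply/orP; left; apply/eqP; field.
pose h' := b / (8 * pi); pose h := Num.min h' (g * h' / (4 * pi)).
have h'0 : 0 < h' by rewrite divr_gt0// mulr_gt0//; lra.
have pi0 := pi_gt0 R; have pi4 : 0 < 4 * pi :> R by lra.
have h0 : 0 < h by rewrite lt_min h'0/=; apply: divr_gt0 => //; apply: mulr_gt0.
have hh' : h <= h' by rewrite /h ge_min lexx.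
have hh : 2 * pi * (h + h') <= b / 2.
  have : 2 * pi * (h + h') <= 2 * pi * (h' + h').
    by rewrite ler_pM2l ?lerD2r//; lra.
  move/le_trans; apply; rewrite /h' le_eqVlt; apply/orP; left; apply/eqP.
  by field; rewrite gt_eqF//; lra.
have hg : 4 * pi * h <= g * h'.
  rewrite mulrC -ler_pdivlMr; last by rewrite mulr_gt0//; lra.
  by rewrite ge_min lexx orbT.
exists h => // sigma S0 HS i s t si st tSh; rewrite leNgt; apply/negP => bad.
pose T := sigma + h.
have T0 : 0 <= T by rewrite /T; lra.
have [P HP] := @boolp.choice _ _ _ (fun j => max_drop g T0 (@u_continuous j)).
pose m j := u (P j).1 j - u (P j).2 j - g * (P j).2.
have mP j x y : 0 <= x -> x <= y -> y <= T -> u x j - u y j - g * y <= m j.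
  by move=> x0 xy yT; have [_ _ _] := HP j; apply.
have m_ub : ubound (range m) (2 * pi * T).
  move=> _ [j _ <-]; have [p0 p1 pT _] := HP j.
  have := flow_drop_le j p0 p1; rewrite -/(m j).
  have : 2 * pi * ((P j).2 - (P j).1) <= 2 * pi * T by rewrite ler_pM2l//; lra.
  have : 0 <= g * (P j).2 by rewrite mulr_ge0 ?(ltW g0)// (le_trans p0).
  rewrite /m; lra.
have m_sup : has_sup (range m) by split; [exists (m i), i|exists (2 * pi * T)].
pose M := sup (range m).
have mM j : m j <= M by apply: sup_upper_bound => //; exists j.
have bM : b < M by apply: lt_le_trans bad _; apply: le_trans (mM i); exact: mP.
(* The first bound makes every m above M - d exceed b, hence be attained after
   sigma; the second makes the error of log_curvature_drop at most g / 2. *)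
pose d := Num.min (M - b) (g * s0 ^+ 2 / (4 * pi)).
have d0 : 0 < d.
  by rewrite lt_min subr_gt0 bM divr_gt0 ?mulr_gt0 ?exprn_gt0//; lra.
have dM : d <= M - b by rewrite ge_min lexx.
have dg : 4 * pi * d <= g * s0 ^+ 2.
  rewrite mulrC -ler_pdivlMr; last by rewrite mulr_gt0//; lra.
  by rewrite ge_min lexx orbT.
have next j : M - d < m j -> exists2 j', heavy nbr Theta k j' j & m j < m j'.
  move=> Mj; apply: contrapT => noj'.
  have [p0 p12 pT _] := HP j.
  set s' := (P j).1 in p0 p12; set t' := (P j).2 in p12 pT.
  have mj : m j = u s' j - u t' j - g * t' by [].
  have bj : b < m j by lra.
  have t0 : 0 <= t' by exact: le_trans p12.
  have gt0 : 0 <= g * t' by rewrite mulr_ge0// ltW.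
  have st' : s' < t'.
    rewrite lt_neqAle p12 andbT; apply/eqP => E.
    suff : b <= 0 by rewrite leNgt b0.
    by move: bj; rewrite mj E; lra.
  have Ks : K (u s') j <= 0.
    apply: curvature_at_max => // x x0 xs; have := mP j x t' x0 _ pT.
    by rewrite mj => /(_ (ltW (lt_trans xs st'))); lra.
  have Kt : g <= K (u t') j.
    have tp : 0 < t' by exact: le_lt_trans st'.
    have dN : is_derive t' 1 (fun x => - u x j) (K (u t') j).
      by rewrite -[K _ _]opprK; apply: is_deriveN; exact: u_flow.
    apply: (derive_ge_left st' dN) => x sx xt.
    have := mP j s' x p0 sx (le_trans (ltW xt) pT); rewrite mj; lra.
  have : K (u t') j <= 2 * pi * (d / (1 - k ^+ 2)).
    apply: (@log_curvature_drop _ _ _ _ ThetaP (u s') (u t') j k (u s' j - u t' j)) => //.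
    - by rewrite k0 k1.
    - by lra.
    - rewrite (ltW d0) kE /=.
      have : d * 1 <= d * (4 * pi) by rewrite ler_pM2l//; lra.
      have : g * s0 ^+ 2 <= s0 ^+ 2 by rewrite ler_piMl// sqr_ge0.
      lra.
    - by ring.
    - by move=> j'; have := mP j' s' t' p0 p12 pT; have := mM j'; lra.
    - move=> j' hj; have : m j' <= m j.
        rewrite leNgt; apply/negP => jj'; apply: noj'; exists j' => //.
        have /andP[nj cj] := hj; have [E _] := ThetaP nj.
        by rewrite /heavy nbr_sym//= -E.
      by have := mP j' s' t' p0 p12 pT; lra.
  apply/negP; rewrite -ltNge; apply: lt_le_trans Kt.
  rewrite kE mulrA ltr_pdivrMr ?exprn_gt0//.
  have : 0 < g * s0 ^+ 2 by rewrite mulr_gt0// exprn_gt0.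
  lra.
pose link j j' := heavy nbr Theta k j j' && (m j' < m j).
(* The chains grow at the head: m decreases along them, which makes their
   vertices distinct. *)
have chains n : exists v p, [/\ size p = n, path link v p &
    forall j, j \in v :: p -> M - d < m j].
  elim: n => [|n [v [p [sp vp Mvp]]]].
    have [_ [v _ <-] Mv] := sup_adherent d0 m_sup.
    by exists v, [::]; split=> // j; rewrite inE => /eqP ->.
  have Mv := Mvp v (mem_head _ _); have [w hw mw] := next v Mv.
  exists w, (v :: p); split => [|/=|j]; first by rewrite /= sp.
    by rewrite /link hw mw.
  by rewrite inE => /predU1P[->|/Mvp//]; exact: lt_trans mw.
have [n nP] : exists n : nat, 8 * pi <= n%:R * g.
  exists (Num.truncn (8 * pi / g)).+1.
  by rewrite -ler_pdivrMr// ltW// truncnS_gt.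
have [v [p [sp vp Mvp]]] := chains n.
have uvp : uniq (v :: p).
  apply: (@sorted_uniq _ (fun j j' => m j' < m j)).
  - by move=> y x z /= yx zy; exact: lt_trans yx.
  - by move=> x; exact: ltxx.
  - by apply: sub_path vp => x y /andP[].
have hvp : path (heavy nbr Theta k) v p by apply: sub_path vp => x y /andP[].
have late j : j \in v :: p -> [/\ 0 <= sigma - h', g * h' / 2 <= u (sigma - h') j - u sigma j &
    forall x : R, sigma - h' <= x -> x <= sigma -> u x j <= - (b / 2)].
  move=> /Mvp Mj; have [p0 p12 pT _] := HP j.
  have bj : b < m j by lra.
  apply: (late_drop b0 g0 S0 h0 h'0 hh hg HS p0 p12 _ pT bj).
  by case: leP => // /ltW pS; have := HS j _ _ p0 p12 pS; rewrite -/(m j) leNgt bj.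
have [sigma'0 _ _] := late v (mem_head _ _).
have := no_late_chain b0 g01 k0 h'0 sigma'0 kg uvp hvp.
rewrite sp => H; have : n%:R * g < 8 * pi.
  by apply: H => j /late[].
by rewrite ltNge nP.
Qed.

Lemma drops_le_all T : 0 < b -> 0 < g <= 1 -> drops_le T.
Proof.
move=> b0 g01; have [h h0 H] := drops_le_step b0 g01.
have Hn n : drops_le (n%:R * h).
  elim: n => [|n IH]; last first.
    by rewrite -natr1 mulrDl mul1r; apply: H => //; rewrite mulr_ge0// ltW.
  rewrite mul0r => i s t s0 st t0.
  have -> : t = 0 by apply/eqP; rewrite eq_le t0 (le_trans s0).
  have -> : s = 0 by apply/eqP; rewrite eq_le s0 (le_trans st).
  by rewrite subrr mulr0 subr0 ltW.
move=> i s t s0 st tT; apply: (Hn (Num.truncn (T / h)).+1) => //.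
by apply: le_trans tT _; rewrite -ler_pdivrMr// ltW// truncnS_gt.
Qed.

End Step.

Lemma flow_nondecreasing i (s t : R) : 0 <= s -> s <= t -> u s i <= u t i.
Proof.
move=> s0 st; have t0 := le_trans s0 st.
apply/ler_addgt0Pr => e e0.
have g0 : 0 < Num.min 1 (e / 2 / (t + 1)) by rewrite lt_min ltr01 !divr_gt0//; lra.
have g01 : 0 < Num.min 1 (e / 2 / (t + 1)) <= 1 by rewrite g0 ge_min lexx.
have e20 : 0 < e / 2 by lra.
have := @drops_le_all _ _ t e20 g01 i s t s0 st (lexx t).
have : Num.min 1 (e / 2 / (t + 1)) * t <= e / 2.
  apply: (@le_trans _ _ (e / 2 / (t + 1) * (t + 1))).
    by apply: ler_pM => //; [exact: ltW|rewrite ge_min lexx orbT|lra].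
  by rewrite divfK// gt_eqF//; lra.
lra.
Qed.

Lemma flow_curvature_le0 i (t : R) : 0 <= t -> K (u t) i <= 0.
Proof.
move=> t0; apply: curvature_at_max => // x x0 xt.
exact: flow_nondecreasing (ltW xt).
Qed.

Lemma angle_vanishing_seq i (s : seq V) (e : R) : {subset s <= nbr i} -> 0 < e ->
  exists2 a0 : R, 0 < a0 < 1 & forall j a b, j \in s -> a0 <= a -> a < 1 -> 0 < b ->
    angle (Theta i j) a b <= e.
Proof.
move=> + e0; elim: s => [_|j s IH sub]; first by exists 2^-1 => //; lra.
have [j0|a1 /andP[a10 a11] H1] := IH; first by move=> js; rewrite sub// inE js orbT.
have [_ T0pi] := ThetaP (sub j (mem_head _ _)).
have [a2 /andP[a20 a21] H2] := angle_vanishing T0pi e0.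
exists (Num.max a1 a2); first by rewrite lt_max a10/= gt_max a11.
move=> j' a b; rewrite inE ge_max => /predU1P[->|js] /andP[aa1 aa2] a1' b0.
  exact: H2.
exact: H1.
Qed.

(** Close to 0 all angles at [i] would be smaller than [pi] divided by the degree,
    and their sum smaller than [pi]. *)
Lemma flow_bounded_away i : exists2 z : R, z < 0 & forall t : R, 0 <= t -> u t i <= z.
Proof.
have pi0 := pi_gt0 R.
have e0 : 0 < pi / (size (nbr i)).+1%:R :> R by rewrite divr_gt0.
have [a0 /andP[a00 a01] H] := @angle_vanishing_seq i (nbr i) _ (fun _ => id) e0.
exists (ln a0); first by rewrite ln_lt0// a00.
move=> t t0; rewrite leNgt; apply/negP => uz.
have au : a0 <= expR (u t i) by rewrite -[leLHS]lnK// ler_expR ltW.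
have := flow_curvature_le0 i t0; apply/negP; rewrite -ltNge /log_curvature.
suff : \sum_(j <- nbr i) edge_angle Theta (u t) i j < pi by lra.
apply: (@le_lt_trans _ _ (\sum_(j <- nbr i) (pi / (size (nbr i)).+1%:R))).
  rewrite big_seq [leRHS]big_seq; apply: ler_sum => j ij.
  by apply: H; rewrite ?expR_gt0 ?expR_lt1.
rewrite big_const_seq count_predT iter_addr addr0 -[_ / _ *+ _]mulr_natr mulrAC.
by rewrite ltr_pdivrMr// ltr_pM2l// ltr_nat.
Qed.

Lemma flow_cvg i : exists2 l : R, l < 0 & u t i @[t --> +oo] --> l.
Proof.
have [z z0 uz] := flow_bounded_away i.
pose A := [set u t i | t in [set t | 0 <= t]].
have A_sup : has_sup A.
  split; first by exists (u 0 i); exists 0 => //=; exact: lexx.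
  by exists z => _ [t t0 <-]; apply: uz.
exists (sup A).
  by apply: le_lt_trans z0; apply: ge_sup => [|_ [t t0 <-]]; [case: A_sup|exact: uz].
apply/cvgrPdist_le => e e0.
have [_ [s s0 <-] As] := sup_adherent e0 A_sup.
near=> t.
have st : s <= t by near: t; exact: nbhs_pinfty_ge (num_real s).
have tA : u t i <= sup A.
  by apply: sup_upper_bound => //; exists t => //; exact: le_trans s0 st.
rewrite ger0_norm ?subr_ge0//.
have := flow_nondecreasing i s0 st; lra.
Unshelve. all: by end_near. Qed.

Theorem log_flow_cvg : exists l : V -> R, forall i,
  [/\ l i < 0, u t i @[t --> +oo] --> l i & K l i = 0].
Proof.
have /boolp.choice[l lP] : forall i, exists l : R, l < 0 /\ u t i @[t --> +oo] --> l.
  by move=> i; have [l] := flow_cvg i; exists l.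
have Kl i : K (u t) i @[t --> +oo] --> K l i.
  apply: cvgB; first exact: cvg_cst.
  apply: cvgM; first exact: cvg_cst.
  rewrite big_seq.
  rewrite (_ : (fun _ => _) = fun t =>
      \sum_(j <- nbr i | j \in nbr i) edge_angle Theta (u t) i j); last first.
    by apply/funext => t; rewrite big_seq.
  apply: cvg_big => [|j ij]; first exact: add_continuous.
  have [_ T0pi] := ThetaP ij.
  have [li0 li] := lP i; have [lj0 lj] := lP j.
  apply: cvg_angle => //; rewrite ?expR_gt0 ?expR_lt1//;
   by apply: continuous_cvg => //; exact: continuous_expR.
exists l => i; have [li0 li] := lP i; split=> //.
case: (ltgtP (K l i) 0) => // Kli.
  (* Past s the slope of u is at least c, so u would be positive at t. *)
  pose c := - K l i / 2; have c0 : 0 < c by rewrite /c; lra.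
  have [M [_ HM]] : \forall t \near +oo, K (u t) i <= - c.
    by apply: (cvgr_le _ (Kl i)); rewrite /c; lra.
  pose s := Num.max 0 (M + 1); pose t := s + (1 - u s i) / c.
  have [s0 sM] : 0 <= s /\ M < s.
    by rewrite /s le_max lexx lt_max ltrDl ltr01 orbT.
  have st : s <= t.
    by rewrite /t lerDl divr_ge0// ?(ltW c0)//; have := u_lt0 s i; lra.
  have : c * (t - s) <= u t i - u s i.
    apply: (increment_ge st (@u_continuous i)
      (fun x sx _ => u_flow i (le_lt_trans s0 sx))) => x sx xt.
    by rewrite lerNr HM// (lt_trans sM).
  rewrite /t addrAC subrr add0r mulrC divfK ?gt_eqF//.
  by have := u_lt0 t i; rewrite /t; lra.
have [M [_ HM]] : \forall t \near +oo, 0 < K (u t) i.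
  exact: (cvgr_gt _ (Kl i) _ Kli).
have := flow_curvature_le0 i (t := Num.max 0 (M + 1)).
rewrite le_max lexx => /(_ isT); rewrite leNgt HM//.
by rewrite lt_max ltrDl ltr01 orbT.
Qed.

End Flow.

(** * From the cell decomposition to the graph *)

Section Curvature.
Variables (R : realType) (S : topologicalType) (D : cell_decomposition R S).
Variable Theta : vertex D -> vertex D -> R.
Hypothesis Theta_angle : intersection_angle Theta.

(** An enumeration of the neighbours turns the finitely supported sum in the
    curvature into a sum over a sequence. *)
Definition neighbours (i : vertex D) : seq (vertex D) := fset_set [set j | adj i j].

Lemma mem_neighbours i j : (j \in neighbours i) <-> adj i j.
Proof.
rewrite /neighbours in_fset_set; last exact: degree_finite.
by rewrite inE.
Qed.

Definition log_radius (x : R) : R := ln (tanh_half x).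

Lemma log_radius_lt0 x : 0 < x -> log_radius x < 0.
Proof. by move=> x0; rewrite ln_lt0// tanh_half_itv. Qed.

Definition inv_log_radius (z : R) : R := ln ((1 + expR z) / (1 - expR z)).

Lemma log_radiusK x : 0 < x -> inv_log_radius (log_radius x) = x.
Proof.
move=> x0; have /andP[t0 _] := tanh_half_itv x0.
rewrite /inv_log_radius /log_radius lnK// -[RHS]expRK; congr ln.
rewrite /tanh_half; have := expR_gt0 x; move: (expR x) => e e0.
by field; rewrite !gt_eqF//; lra.
Qed.

Lemma inv_log_radius_gt0 z : z < 0 -> 0 < inv_log_radius z.
Proof.
move=> z0; have /andP[e0 e1] := expR_neg_itv z0.
by rewrite ln_gt0// ltr_pdivlMr; lra.
Qed.

Lemma inv_log_radiusK z : z < 0 -> log_radius (inv_log_radius z) = z.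
Proof.
move=> z0; have /andP[e0 e1] := expR_neg_itv z0.
rewrite /log_radius -[RHS]expRK; congr ln.
rewrite /tanh_half /inv_log_radius lnK; last by rewrite posrE divr_gt0; lra.
by field; rewrite !gt_eqF//; lra.
Qed.

Lemma continuous_inv_log_radius z : z < 0 -> {for z, continuous inv_log_radius}.
Proof.
move=> z0; have /andP[e0 e1] := expR_neg_itv z0.
apply: continuous_cvg.
  by apply: continuous_ln; rewrite divr_gt0; lra.
apply: cvgM.
  by apply: cvgD; [exact: cvg_cst|exact: continuous_expR].
apply: cvgV; first by rewrite gt_eqF//; lra.
by apply: cvgB; [exact: cvg_cst|exact: continuous_expR].
Qed.

Lemma continuous_log_radius x : 0 < x -> {for x, continuous log_radius}.
Proof.
move=> x0; apply: differentiable_continuous; apply/derivable1_diffP.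
by have [] := is_derive_ln_tanh_half x0.
Qed.

Lemma curvatureE rho i : circle_packing_metric rho ->
  curvature Theta rho i = log_curvature neighbours Theta (fun j => log_radius (rho j)) i.
Proof.
move=> rho0; rewrite /curvature /log_curvature fsbig_finite; last exact: degree_finite.
congr (_ - _ * _); rewrite big_seq [RHS]big_seq; apply: eq_bigr => j /mem_neighbours ij.
have [_ T0pi] := Theta_angle ij.
rewrite inner_angleE// /edge_angle /log_radius !lnK// posrE.
  by have /andP[] := tanh_half_itv (rho0 j).
by have /andP[] := tanh_half_itv (rho0 i).
Qed.

End Curvature.

Theorem theorem1p7 (R : realType) (S : topologicalType)
    (D : cell_decomposition R S) (Theta : vertex D -> vertex D -> R)
    (r : R -> vertex D -> R) :
  is_surface R S -> ~ compact [set: S] ->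
  infinite_set [set: vertex D] ->
  intersection_angle Theta -> condition_C1 Theta ->
  ricci_flow Theta r ->
  (forall i : vertex D, curvature Theta (r 0) i <= 0) ->
  exists rinf : vertex D -> R,
    (forall i : vertex D, r t i @[t --> +oo] --> rinf i) /\
    good_ideal_circle_pattern Theta rinf.
Proof.
move=> _ _ _ Theta_angle _ flow K0.
(* rho extends r by its initial value to negative times. *)
pose rho (t : R) i := r (Num.max 0 t) i.
pose u (t : R) i := log_radius (rho t i).
have max0 (t : R) : 0 <= Num.max 0 t by rewrite le_max lexx.
have rho0 t : circle_packing_metric (rho t) by have [] := flow _ (max0 t).
have KE t i : curvature Theta (rho t) i = log_curvature (@neighbours R S D) Theta (u t) i.
  exact: curvatureE.
have rhoE t : 0 <= t -> rho t = r t.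
  by move=> t0; apply/funext => i; rewrite /rho max_r.
have u_cont i : continuous (u ^~ i).
  move=> t; apply: continuous_cvg; first exact: (continuous_log_radius (rho0 t i)).
  apply: (@is_derive_nneg_continuous _ (r ^~ i)) => {}t t0.
  by have [_ /(_ i)] := flow _ t0; eexists; eassumption.
have u_flow (t : R) i : 0 < t ->
    is_derive t 1 (u ^~ i) (- log_curvature (@neighbours R S D) Theta (u t) i).
  move=> t0; have [rt0 /(_ i)/(is_derive_nneg_is_derive t0) dr] := flow _ (ltW t0).
  have drho : is_derive t 1 (rho ^~ i) (- curvature Theta (r t) i * sinh (r t i)).
    apply: near_eq_is_derive dr; near=> s; rewrite /rho max_r//.
    by near: s; apply: (cvgr_ge t cvg_id).
  have dl := is_derive_ln_tanh_half (rho0 t i).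
  apply: (is_derive_eq (is_derive1_comp dl drho)).
  by rewrite -KE rhoE ?ltW// mulrC mulrK// unitfE gt_eqF// sinh_gt0.
have nbr_sym (i j : vertex D) : j \in neighbours i -> i \in neighbours j.
  by move=> /mem_neighbours/adj_sym ij; apply/mem_neighbours.
have ThetaP (i j : vertex D) : j \in neighbours i -> Theta i j = Theta j i /\ 0 < Theta i j < pi.
  by move=> /mem_neighbours/Theta_angle.
have u0_curv i : log_curvature (@neighbours R S D) Theta (u 0) i <= 0.
  by rewrite -KE rhoE.
have [l lP] := @log_flow_cvg R (vertex D) (@neighbours R S D) Theta (fun=> fset_uniq _)
  nbr_sym ThetaP u (fun t i => log_radius_lt0 (rho0 t i)) u_cont u_flow u0_curv.
have l0 i : l i < 0 by have [] := lP i.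
exists (fun i => inv_log_radius (l i)); split=> [i|].
  have [_ ul _] := lP i.
  have : inv_log_radius (u t i) @[t --> +oo] --> inv_log_radius (l i).
    by apply: continuous_cvg => //; exact: continuous_inv_log_radius.
  apply: cvg_trans; apply: near_eq_cvg; near=> t.
  have t0 : 0 <= t by near: t; exact: nbhs_pinfty_ge (num_real 0).
  by rewrite /u (log_radiusK (rho0 t i)) rhoE.
have linf0 : circle_packing_metric (fun i => inv_log_radius (l i)).
  by move=> i; exact: inv_log_radius_gt0.
split=> // i; rewrite curvatureE//.
have [_ _ <-] := lP i; congr log_curvature.
by apply/funext => j; rewrite inv_log_radiusK.
Unshelve. all: by end_near. Qed.
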